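(* For $0\leq k\leq n$, $$\hat{\gamma}_{n,k}^{(2)} = \sum_{i=0}^k \gamma_{n,i}^{(2)} 2^{k-i} \binom{n-i}{k-i}.$$ Furthermore, $$D_n^{(2)}(t)=\sum_{k\geq 0}\hat{\gamma}^{(2)}_{n,k}t^{k}(1+t^2)^{n-k},\qquad d_n^{(2)}(t)=\sum_{k\geq 0}\hat{\gamma}^{(2)}_{n,k}t^{\lceil k/2\rceil}(1+t)^{n-k}.$$
   Context: $\mathfrak{B}_n=\mathbb{Z}_2\wr\mathfrak{S}_n$ is the set of colored permutations $\sigma=\binom{\pi}{\mathbf z}$, $\pi\in\mathfrak{S}_n$, $\mathbf z\in\{0,1\}^n$. $\sigma$ is a derangement if there is no $i$ with $\pi_i=i$, $z_i=0$; $\mathfrak{D}_n^{(2)}$ is the set of derangements. $\operatorname{exc}\sigma=\#\{i:\pi_i>i\text{, or }\pi_i=i\text{ and }z_i=1\}$; $\operatorname{fexc}\sigma=2\#\{i:z_i=0,\ i<\pi_i\}+\#\{i:z_i=1\}$. $D_n^{(2)}(t)=\sum_{\sigma\in\mathfrak{D}_n^{(2)}}t^{\operatorname{fexc}\sigma}$, $d_n^{(2)}(t)=\sum_{\sigma\in\mathfrak{D}_n^{(2)}}t^{\operatorname{exc}\sigma}$, with $D_0^{(2)}=d_0^{(2)}=1$. For $\tau\in\mathfrak{S}_n$: a weak excedance is $i$ with $i\le\tau(i)$ ($\operatorname{wex}\tau$ their number), a drop is $i$ with $i>\tau(i)$, and a double excedance is $i$ with $i<\tau(i)<\tau^2(i)$.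 $\gamma^{(2)}_{n,k}$ is the number of $\tau\in\mathfrak{S}_n$ with $\operatorname{wex}\tau=k$ and no double excedance. A drop-colored permutation is a permutation $\tau\in\mathfrak{S}_n$ in which some of the drops are colored, each colored drop receiving one of two colors (bar or tilde); $\operatorname{cdrop}(\tau)$ is the number of colored drops. $\mathcal{Z}_n$ is the set of drop-colored permutations of $[n]$ without double excedance, and $\hat\gamma^{(2)}_{n,k}$ is the number of elements of $\mathcal{Z}_n$ with $\operatorname{wex}+\operatorname{cdrop}=k$. $\lceil x\rceil$ is the least integer $\ge x$. *)

(* Defs.v *)
From mathcomp Require Import all_boot all_order all_fingroup all_algebra.

Set Implicit Arguments.
Unset Strict Implicit.
Unset Printing Implicit Defensive.

Import GRing.Theory.

Local Open Scope nat_scope.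

(* Positions are 0-based, which affects none of the statistics below, as they
   only compare positions and values. *)

(* sigma = (pi, z), where [z i = true] stands for z_i = 1. *)
Notation colored_perm n := ('S_n * {ffun 'I_n -> bool})%type.

Section ColoredPermutations.
Variable n : nat.
Implicit Type s : colored_perm n.

Definition is_derangement s : bool := ~~ [exists i, (s.1 i == i) && ~~ s.2 i].

Definition derangements : {set colored_perm n} := [set s | is_derangement s].

Definition exc s : nat := #|[set i : 'I_n | (i < s.1 i) || (s.1 i == i) && s.2 i]|.

Definition fexc s : nat :=
  2 * #|[set i : 'I_n | ~~ s.2 i & i < s.1 i]| + #|[set i : 'I_n | s.2 i]|.

End ColoredPermutations.

Definition Dpoly (n : nat) : {poly int} :=
  (\sum_(s in derangements n) 'X^(fexc s))%R.

Definition dpoly (n : nat) : {poly int} :=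
  (\sum_(s in derangements n) 'X^(exc s))%R.

Section Permutations.
Variable n : nat.
Implicit Type t : 'S_n.

Definition wex t : nat := #|[set i : 'I_n | i <= t i]|.

Definition is_drop t (i : 'I_n) : bool := t i < i.

Definition is_double_exc t (i : 'I_n) : bool := i < t i < t (t i).

Definition no_double_exc t : bool := ~~ [exists i, is_double_exc t i].

End Permutations.

Definition gamma2 (n k : nat) : nat :=
  #|[set t : 'S_n | (wex t == k) && no_double_exc t]|.

(* [None]: uncolored; [Some false]: bar; [Some true]: tilde. *)
Notation coloring n := {ffun 'I_n -> option bool}.

Definition is_drop_coloring (n : nat) (t : 'S_n) (c : coloring n) : bool :=
  [forall i, (c i != None) ==> is_drop t i].

Definition cdrop (n : nat) (c : coloring n) : nat := #|[set i | c i != None]|.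

Definition Zset (n : nat) : {set 'S_n * coloring n} :=
  [set x | is_drop_coloring x.1 x.2 & no_double_exc x.1].

Definition gammahat2 (n k : nat) : nat :=
  #|[set x in Zset n | wex x.1 + cdrop x.2 == k]|.

(* Hence a sum over all k >= 0 weighted by [gammahat2 n k] is the sum over
   k < n.+1. *)
Lemma gammahat2_eq0 (n k : nat) : n < k -> gammahat2 n k = 0.
Proof.
move=> ltnk; apply/eqP; rewrite cards_eq0; apply/eqP/setP=> -[t c].
rewrite !inE /=; apply/negP=> /andP[/andP[/forallP dc _] /eqP wck].
suff: wex t + cdrop c <= n by rewrite wck leqNgt ltnk.
rewrite -[X in _ <= X]card_ord -(cardsC [set i : 'I_n | i <= t i]) leq_add2l.
apply: subset_leq_card; apply/subsetP=> i; rewrite !inE -ltnNge => ci.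
by move/implyP: (dc i); apply.
Qed.

(* Main.v *)
(** Classify the points of a permutation by comparing them with their image and
    their preimage: fixed points, peaks (as many as valleys), double ascents and
    double descents. Inserting a new maximum into a cycle changes the type of a
    single old point, so a sum over 'S_(n+1) of a function of the four counts is
    the sum over 'S_n of an explicit transform of that function. This transform
    treats double ascents and double descents alike, hence the sum only depends
    on the binomial averages over both; summing out the colors, this identifies
    [Dpoly n = \sum_s 'X^(wex s) * (1 + 'X) ^+ (n - fix s)] with
    [\sum_s 'X^(wex s) * (1 + 'X) ^+ (2 * (n - wex s))] over the [s] without
    double excedance, which is the expansion in the [gammahat2 n k].
    For [dpoly], the same transform gives [(1 + 'X) * Dpoly n] and
    [dpoly n \Po 'X^2] a common recurrence that is invariant under [X |-> -X].
    Therefore [2 * (dpoly n \Po 'X^2)] is the sum of [(1 + X) * Dpoly n] and its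
    image under [X |-> -X], and that operation sends ['X^k] to
    [2 * 'X^(2 * uphalf k)]. *)
Require Import Defs.
From mathcomp Require Import all_boot all_order all_fingroup all_algebra.
From mathcomp Require Import ring zify.

Set Implicit Arguments.
Unset Strict Implicit.
Unset Printing Implicit Defensive.

Import GRing.Theory.

Local Open Scope nat_scope.

(** * Cyclic types of the points of a permutation *)

Section CyclicType.
Variable n : nat.
Implicit Types (s : 'S_n) (x : 'I_n).

Definition cyc_type s x : option (bool * bool) :=
  if s x == x then None else Some ((s^-1)%g x < x, x < s x).

Definition count_type s T : nat := \sum_x (cyc_type s x == T).

Definition fixpts s := count_type s None.
Definition valleys s := count_type s (Some (false, true)).
Definition peaks s := count_type s (Some (true, false)).
Definition dascs s := count_type s (Some (true, true)).
Definition ddescs s := count_type s (Some (false, false)).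

Lemma sum_count_types s :
  fixpts s + valleys s + peaks s + dascs s + ddescs s = n.
Proof.
rewrite -[RHS]card_ord -sum1_card -!big_split; apply: eq_bigr => x _ /=.
by case: cyc_type => [[[] []]|].
Qed.

Lemma wex_count s : wex s = fixpts s + valleys s + dascs s.
Proof.
rewrite /wex -sum1_card big_mkcond -!big_split; apply: eq_bigr => x _ /=.
rewrite inE /cyc_type leq_eqVlt (_ : (_ == _ :> nat) = (s x == x)) 1?eq_sym //.
by case: (x == s x) => //; case: (x < s x); case: (_ < _).
Qed.

(** Adding [dascs s] to both sides, the left counts the tails of rising arcs and the right counts
    their heads; [s] maps tails to heads bijectively. *)
Lemma valleys_eq_peaks s : valleys s = peaks s.
Proof.
suff: valleys s + dascs s = peaks s + dascs s by lia.
rewrite -!big_split /= [RHS](reindex_inj (@perm_inj _ s)) /=.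
apply: eq_bigr => x _.
rewrite /cyc_type permK (inj_eq (@perm_inj _ s)).
by case: (s x == x) => //; case: (x < s x); case: (_ < x); case: (s x < _).
Qed.

(** A double excedance at [i] is a double ascent at the middle point [s i]. *)
Lemma no_double_exc_count s : no_double_exc s = (dascs s == 0).
Proof.
rewrite /no_double_exc /dascs /count_type sum_nat_eq0 negb_exists.
apply/forallP/forallP => H x.
  rewrite /cyc_type; case: (s x == x) => //=.
  have := H ((s^-1)%g x); rewrite /is_double_exc !permKV.
  by do 2!case: (_ < _).
have := H (s x); rewrite /is_double_exc /cyc_type permK (inj_eq (@perm_inj _ s)).
have [->|_] := eqVneq (s x) x; first by rewrite ltnn.
by do 2!case: (_ < _).
Qed.

End CyclicType.

(** * Inserting a new maximum into a cycle *)

Section Insertion.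
Variable n : nat.
Implicit Types (s : 'S_n) (x i : 'I_n).

(** The maximum is placed on the arc leaving [j]; the choice [j = ord_max] makes it a fixed
    point. *)
Definition insert_max s (j : 'I_n.+1) : 'S_n.+1 :=
  (tperm j ord_max * lift_perm ord_max ord_max s)%g.

Lemma insert_max_at s j : insert_max s j j = ord_max.
Proof. by rewrite permM tpermL lift_perm_id. Qed.

Lemma insert_max_inj : injective (fun p : 'S_n * 'I_n.+1 => insert_max p.1 p.2).
Proof.
move=> [s j] [s' j'] /= eq_ins.
have eqj : j = j'.
  by apply: (@perm_inj _ (insert_max s j)); rewrite {2}eq_ins !insert_max_at.
subst j'; congr (_, _); apply/permP => x.
apply: (@lift_inj _ ord_max); rewrite -!(lift_perm_lift ord_max).
by rewrite (mulgI _ _ _ eq_ins).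
Qed.

Lemma big_insert_max (R : nmodType) (G : 'S_n.+1 -> R) :
  (\sum_s G s = \sum_s \sum_j G (insert_max s j))%R.
Proof.
rewrite pair_big /= (reindex (fun p => insert_max p.1 p.2)) //=.
apply: onW_bij; apply: inj_card_bij; first exact: insert_max_inj.
by rewrite card_prod card_ord !card_Sn factS mulnC.
Qed.

Lemma insert_max_fix s : insert_max s ord_max = lift_perm ord_max ord_max s.
Proof. by rewrite /insert_max tperm1 mul1g. Qed.

Lemma insert_max_max s i :
  insert_max s (lift ord_max i) ord_max = lift ord_max (s i).
Proof. by rewrite permM tpermR lift_perm_lift. Qed.

Lemma insert_max_lift s i x :
  x != i -> insert_max s (lift ord_max i) (lift ord_max x) = lift ord_max (s x).
Proof.
move=> neq_xi; rewrite permM tpermD ?lift_perm_lift ?neq_lift //.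
by rewrite (inj_eq (@lift_inj _ _)) eq_sym.
Qed.

Lemma insert_maxV_max s i :
  ((insert_max s (lift ord_max i))^-1)%g ord_max = lift ord_max i.
Proof. by rewrite -{2}(insert_max_at s (lift ord_max i)) permK. Qed.

Lemma insert_maxV_img s i :
  ((insert_max s (lift ord_max i))^-1)%g (lift ord_max (s i)) = ord_max.
Proof. by rewrite -(insert_max_max s i) permK. Qed.

Lemma insert_maxV_lift s i x : x != s i ->
  ((insert_max s (lift ord_max i))^-1)%g (lift ord_max x)
  = lift ord_max ((s^-1)%g x).
Proof.
move=> neq_x; have neq_x' : (s^-1)%g x != i.
  by rewrite -(inj_eq (@perm_inj _ s)) permKV.
by rewrite -{1}(permKV s x) -(insert_max_lift s neq_x') permK.
Qed.

Lemma count_insert_max_fix s T :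
  count_type (insert_max s ord_max) T = count_type s T + (T == None).
Proof.
rewrite insert_max_fix /count_type big_ord_recr /=; congr (_ + _).
  apply: eq_bigr => x _.
  have -> : widen_ord (leqnSn n) x = lift ord_max x.
    by apply: val_inj; rewrite /= /bump leqNgt ltn_ord.
  rewrite /cyc_type lift_permV !lift_perm_lift (inj_eq (@lift_inj _ _)).
  by rewrite !lift_max.
by rewrite /cyc_type lift_perm_id eqxx eq_sym.
Qed.

(* Only one old point changes its type: the head of the arc [i -> s i] that
   receives the maximum if this arc goes up, and its tail otherwise. *)
Definition touched s i := if i < s i then s i else i.

(** On a rising arc the maximum becomes the preimage of the head, which clears its first bit; on a
    falling arc it becomes the image of the tail, which sets its second bit. On a loop it does both,
    leaving a valley. *)
Definition touched_type s i : option (bool * bool) :=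
  match cyc_type s (touched s i) with
  | None => Some (false, true)
  | Some (a, b) => if i < s i then Some (false, b) else Some (a, true)
  end.

Lemma cyc_type_insert_max s i :
  cyc_type (insert_max s (lift ord_max i)) ord_max = Some (true, false).
Proof.
rewrite /cyc_type insert_max_max insert_maxV_max !lift_max /= !ltn_ord.
by rewrite eq_sym (negbTE (neq_lift _ _)) ltnNge ltnW.
Qed.

Lemma cyc_type_insert_touched s i :
  cyc_type (insert_max s (lift ord_max i)) (lift ord_max (touched s i))
  = touched_type s i.
Proof.
rewrite /touched_type /touched; case: (ltnP i (s i)) => [lt_is|le_si].
  have neq : s i != i by rewrite -val_eqE /= gtn_eqF.
  rewrite /cyc_type insert_max_lift // insert_maxV_img !lift_max.
  rewrite !(inj_eq (@lift_inj _ _)) (inj_eq (@perm_inj _ s)) (negbTE neq).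
  by rewrite /= ltnNge ltnW ?ltn_ord.
rewrite /cyc_type insert_max_at (negbTE (neq_lift _ _)) !lift_max.
rewrite (_ : (i < @ord_max n) = true) ?ltn_ord //.
have [fix_i|neq] := eqVneq (s i) i.
  have := insert_maxV_img s i; rewrite fix_i => ->.
  by rewrite /= ltnNge ltnW ?ltn_ord.
by rewrite insert_maxV_lift ?lift_max // eq_sym.
Qed.

Lemma cyc_type_insert_other s i x : x != touched s i ->
  cyc_type (insert_max s (lift ord_max i)) (lift ord_max x) = cyc_type s x.
Proof.
rewrite /touched /cyc_type; case: (ltnP i (s i)) => [lt_is|le_si] neq.
  rewrite insert_maxV_lift // !lift_max.
  have [->|neq_xi] := eqVneq x i.
    rewrite insert_max_at (negbTE (neq_lift _ _)) /= ltn_ord lt_is.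
    by rewrite -val_eqE gtn_eqF.
  by rewrite insert_max_lift // !lift_max !(inj_eq (@lift_inj _ _)).
rewrite insert_max_lift // !lift_max !(inj_eq (@lift_inj _ _)).
have [->|neq_xsi] := eqVneq x (s i); last by rewrite insert_maxV_lift // lift_max.
rewrite insert_maxV_img permK /= !ltnNge le_si ltnW ?ltn_ord //=.
Qed.

(** The lost type stands on the left to avoid truncated subtraction; the last summand is the maximum
    itself, always a peak here. *)
Lemma count_insert_max s i T :
  count_type (insert_max s (lift ord_max i)) T + (cyc_type s (touched s i) == T)
  = count_type s T + (touched_type s i == T) + (Some (true, false) == T).
Proof.
rewrite {1}/count_type big_ord_recr /= cyc_type_insert_max.
rewrite (eq_bigr (fun x => cyc_type (insert_max s (lift ord_max i))
                                    (lift ord_max x) == T : nat)) => [|x _].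
  rewrite /count_type !(bigD1 (touched s i) isT) /= cyc_type_insert_touched.
  rewrite (eq_bigr (fun x => cyc_type s x == T : nat)) => [|x neq]; first by lia.
  by rewrite cyc_type_insert_other.
congr (nat_of_bool (cyc_type _ _ == _)).
by apply: val_inj; rewrite /= /bump leqNgt ltn_ord.
Qed.

End Insertion.

Local Open Scope ring_scope.

(** * Sums over permutations of a function of the type counts *)

Section StatisticSums.
Variable R : comNzRingType.
Implicit Types phi psi : nat -> nat -> nat -> nat -> R.

Definition stat_sum n phi : R :=
  \sum_(s : 'S_n) phi (fixpts s) (peaks s) (dascs s) (ddescs s).

(** Valleys are never touched by an insertion, while each peak is touched from both of its arcs.
    Truncated predecessors at 0 carry a zero factor. *)
Definition insert_op phi f k i j : R :=
  phi f.+1 k i j + f%:R * phi f.-1 k.+1 i j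
  + k%:R * phi f k i.+1 j + k%:R * phi f k i j.+1
  + i%:R * phi f k.+1 i.-1 j + j%:R * phi f k.+1 i j.-1.

Lemma stat_sum0 phi : stat_sum 0 phi = phi 0 0 0 0.
Proof.
rewrite /stat_sum (eq_bigr (fun=> phi 0 0 0 0)) => [|s _].
  by rewrite sumr_const card_Sn.
by rewrite /fixpts /peaks /dascs /ddescs /count_type !big_ord0.
Qed.

Lemma sum_count_type n (s : 'S_n) T (a : R) :
  \sum_x (if cyc_type s x == T then a else 0) = (count_type s T)%:R * a.
Proof.
rewrite /count_type natr_sum mulr_suml; apply: eq_bigr => x _.
by case: eqP => _; rewrite ?mul1r ?mul0r.
Qed.

(* The two [k]-terms come from a peak [x]: inserting the maximum just before
   [x] turns it into a double descent, just after [x] into a double ascent. *)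
Lemma stat_sumS n phi : stat_sum n.+1 phi = stat_sum n (insert_op phi).
Proof.
rewrite /stat_sum big_insert_max; apply: eq_bigr => s _.
rewrite (bigD1_ord ord_max) //= {1}/fixpts {1}/peaks {1}/dascs {1}/ddescs.
rewrite !count_insert_max_fix /= !addn0 addn1 /insert_op -!addrA; congr (_ + _).
set f := fixpts s; set k := peaks s; set i := dascs s; set j := ddescs s.
(* A rising arc is charged to its head and a falling arc or loop to its tail, so the arc leaving [x]
   contributes [rise (s x) + fall x]; reindexing by [s] then gathers both charges at the same
   point. *)
pose rise x := match cyc_type s x with
  | Some (true, false) => phi f k i j.+1
  | Some (true, true) => phi f k.+1 i.-1 j
  | _ => 0 end.
pose fall x := match cyc_type s x with
  | None => phi f.-1 k.+1 i j
  | Some (true, false) => phi f k i.+1 j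
  | Some (false, false) => phi f k.+1 i j.-1
  | _ => 0 end.
transitivity (\sum_x (rise (s x) + fall x)).
  apply: eq_bigr => x _.
  have cnt := count_insert_max s x.
  have := cnt None; have := cnt (Some (true, false)).
  have := cnt (Some (true, true)); have := cnt (Some (false, false)).
  rewrite -/(fixpts _) -/(peaks _) -/(dascs _) -/(ddescs _).
  rewrite -/(fixpts s) -/(peaks s) -/(dascs s) -/(ddescs s) -/f -/k -/i -/j.
  rewrite /rise /fall /touched_type /touched.
  case: (ltngtP x (s x)) => [lt_xs|gt_xs|/val_inj eq_xs].
  - have -> : cyc_type s x = Some ((s^-1)%g x < x, true)%N.
      by rewrite /cyc_type -val_eqE gtn_eqF ?lt_xs.
    have -> : cyc_type s (s x) = Some (true, s x < s (s x))%N.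
      by rewrite /cyc_type permK lt_xs -val_eqE (inj_eq val_inj)
                 (inj_eq (@perm_inj _ s)) -val_eqE gtn_eqF.
    case: (_ < _)%N => /=; rewrite ?if_same addr0 => *; congr phi; lia.
  - have -> : cyc_type s x = Some ((s^-1)%g x < x, false)%N.
      by rewrite /cyc_type -val_eqE ltn_eqF // [(x < s x)%N]ltnNge (ltnW gt_xs).
    have -> : cyc_type s (s x) = Some (false, s x < s (s x))%N.
      by rewrite /cyc_type permK -val_eqE (inj_eq val_inj)
                 (inj_eq (@perm_inj _ s)) -val_eqE ltn_eqF // [(x < s x)%N]ltnNge (ltnW gt_xs).
    case: (_ < x)%N => /=; rewrite add0r => *; congr phi; lia.
  - have -> : cyc_type s x = None by rewrite /cyc_type -eq_xs eqxx.
    rewrite -eq_xs.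
    have -> : cyc_type s x = None by rewrite /cyc_type -eq_xs eqxx.
    by rewrite /= add0r => *; congr phi; lia.
rewrite big_split /=.
have -> : \sum_x rise (s x) = \sum_x rise x.
  by rewrite [RHS](reindex_inj (@perm_inj _ s)).
rewrite -!sum_count_type -!big_split; apply: eq_bigr => x _ /=.
rewrite /rise /fall.
by case: cyc_type => [[[] []]|] /=; ring.
Qed.

Definition unfix_op phi f k i j : R := f%:R * phi f.-1 k i j.

(** Both sides count permutations with a marked fixed point, which is then deleted. The induction
    rests on the commutation relation: [insert_op] after [unfix_op] exceeds [unfix_op] after
    [insert_op] by the identity. *)
Lemma stat_sum_unfix n phi :
  stat_sum n.+1 (unfix_op phi) = n.+1%:R * stat_sum n phi.
Proof.
have comm psi m : stat_sum m (insert_op (unfix_op psi))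
                = stat_sum m psi + stat_sum m (unfix_op (insert_op psi)).
  rewrite /stat_sum -big_split; apply: eq_bigr => s _ /=.
  rewrite /insert_op /unfix_op; case: (fixpts s) => [|f] /=; ring.
elim: n phi => [|n IHn] phi; rewrite stat_sumS comm.
  by rewrite !stat_sum0 /unfix_op mul0r addr0 mul1r.
by rewrite IHn -stat_sumS; ring.
Qed.

Definition merge_op phi f k i j : R := phi f k i.+1 j + phi f k i j.+1.

(** The commutator of [merge_op] and [insert_op] is twice the shift of [k], one unit each from the
    [i]- and [j]-terms. This shift commutes with [merge_op], so [m] commutations accumulate the
    factor [m.*2]. *)
Lemma iter_merge_insert m phi f k i j :
  iter m merge_op (insert_op phi) f k i j
  = insert_op (iter m merge_op phi) f k i j
    + (m.*2)%:R * iter m.-1 merge_op phi f k.+1 i j.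
Proof.
elim: m f k i j => [|m IHm] f k i j; first by rewrite mul0r addr0.
rewrite iterS {1}/merge_op !IHm /= doubleS.
have -> : (m.*2)%:R * iter m.-1 merge_op phi f k.+1 i.+1 j
          = (m.*2)%:R * iter m merge_op phi f k.+1 i j
            - (m.*2)%:R * iter m.-1 merge_op phi f k.+1 i j.+1.
  by case: m {IHm} => [|m] /=; rewrite ?double0 /merge_op; ring.
move: (iter m merge_op phi) => psi; rewrite -!muln2 /insert_op /merge_op.
by case: i => [|i]; case: j => [|j] /=; ring.
Qed.

(* The moments [iter m merge_op phi f k 0 0] are the binomial sums
   \sum_(i <= m) 'C(m, i) * phi f k i (m - i); so double ascents and double
   descents are exchangeable, and only their total number matters. *)
Lemma eq_stat_sum_merge n phi psi :
  (forall m f k, iter m merge_op phi f k 0 0 = iter m merge_op psi f k 0 0) ->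
  stat_sum n phi = stat_sum n psi.
Proof.
elim: n phi psi => [|n IHn] phi psi eq_m.
  by rewrite !stat_sum0; apply: (eq_m 0).
rewrite !stat_sumS; apply: IHn => m f k; rewrite !iter_merge_insert !eq_m.
congr (_ + _); rewrite /insert_op !mul0r !addr0 !eq_m -!addrA -!mulrDr.
(* At [i = j = 0] the two [k]-terms add up to the next moment. *)
by congr (_ + (_ + _ * _)); apply: (eq_m m.+1).
Qed.

End StatisticSums.

(** * The derangement polynomials as sums over uncolored permutations *)

Lemma prod_perm_types (R : comNzRingType) n (s : 'S_n) (x y z : R) :
  \prod_i (if s i == i then x else if (i < s i)%N then y else z)
  = x ^+ fixpts s * y ^+ (peaks s + dascs s) * z ^+ (peaks s + ddescs s).
Proof.
rewrite -{1}valleys_eq_peaks -!big_split -!prodrXr -!big_split /=.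
apply: eq_bigr => i _; rewrite /cyc_type.
case: (s i == i) => /=; first by rewrite !expr0 !mulr1.
by case: (i < s i)%N; case: (_ < i)%N => /=; rewrite ?expr0 ?expr1 ?mulr1 ?mul1r.
Qed.

(** Being a derangement constrains the colors pointwise: a fixed point must have color 1 and other
    points are free, so the color sum factors. *)
Lemma sum_derangements (R : comNzRingType) n (W : 'S_n -> 'I_n -> bool -> R) :
  \sum_(s in derangements n) \prod_i W s.1 i (s.2 i)
  = \sum_(s : 'S_n)
      \prod_i (if s i == i then W s i true else W s i false + W s i true).
Proof.
transitivity (\sum_(p : 'S_n) \sum_(c : {ffun 'I_n -> bool})
    if (p, c) \in derangements n then \prod_i W p i (c i) else 0).
  by rewrite pair_bigA big_mkcond; apply: eq_bigr => -[p c] _.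
apply: eq_bigr => p _.
rewrite (eq_bigr (fun i => \sum_b (if (p i == i) && ~~ b then 0 else W p i b)));
  last first.
  by move=> i _; rewrite big_bool andbF andbT; case: (p i == i) => /=;
     rewrite ?addr0 1?addrC.
rewrite bigA_distr_bigA; apply: eq_bigr => c _; rewrite inE /is_derangement /=.
case: ifPn => [|/negPn/existsP[i fix_i]].
  move/existsPn => der; apply: eq_bigr => i _.
  by rewrite (negbTE (der i)).
by rewrite (bigD1 i) //= fix_i mul0r.
Qed.

Lemma Dpoly_stat_sum n :
  Dpoly n
  = stat_sum n (fun f k i j => 'X^(f + k + i) * (1 + 'X) ^+ (k + k + i + j)).
Proof.
pose W (s : 'S_n) (i : 'I_n) (b : bool) : {poly int} :=
  'X^(2 * (~~ b && (i < s i)%N) + b).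
rewrite /Dpoly (eq_bigr (fun s : colored_perm n => \prod_i W s.1 i (s.2 i))) => [|s _].
  rewrite sum_derangements; apply: eq_bigr => s _.
  rewrite (eq_bigr (fun i => if s i == i then 'X else
     if (i < s i)%N then 'X * (1 + 'X) else 1 + 'X)) => [|i _].
    by rewrite prod_perm_types !exprMn !exprD; ring.
  rewrite /W; case: (s i == i) => //; case: (_ < _)%N => /=.
    by rewrite /= !expr1; ring.
  by rewrite /= !expr1 expr0.
rewrite prodrXr big_split /= -big_distrr /=; congr 'X^(2 * _ + _).
  by rewrite -sum1_card big_mkcond; apply: eq_bigr => i _; rewrite inE; case: (_ && _).
by rewrite -sum1_card big_mkcond; apply: eq_bigr => i _; rewrite inE; case: (s.2 i).
Qed.

Lemma dpoly_stat_sum n :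
  dpoly n = stat_sum n (fun f k i j => 'X^(f + k + i) * 2 ^+ (k + k + i + j)).
Proof.
pose W (s : 'S_n) (i : 'I_n) (b : bool) : {poly int} :=
  'X^((i < s i)%N || (s i == i) && b).
rewrite /dpoly (eq_bigr (fun s : colored_perm n => \prod_i W s.1 i (s.2 i))) => [|s _].
  rewrite sum_derangements; apply: eq_bigr => s _.
  rewrite (eq_bigr (fun i => if s i == i then 'X else
     if (i < s i)%N then 2 * 'X else 2)) => [|i _].
    by rewrite prod_perm_types !exprMn !exprD; ring.
  rewrite /W; case: (s i == i) => /=; first by rewrite orbT.
  by rewrite orbF; case: (_ < _)%N; rewrite ?expr1 ?expr0; ring.
rewrite prodrXr; congr 'X^_.
by rewrite /exc -sum1_card big_mkcond; apply: eq_bigr => i _; rewrite inE; case: (_ || _).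
Qed.

(** In [Dpoly] a double ascent weighs ['X * (1 + 'X)] and a double descent [1 + 'X]. The total is
    [(1 + 'X) ^+ 2], so giving all of it to double descents and nothing to double ascents preserves
    the moments. *)
Lemma Dpoly_no_double_exc n :
  Dpoly n = \sum_(s : 'S_n | no_double_exc s)
              'X^(wex s) * ((1 + 'X) ^+ 2) ^+ (n - wex s).
Proof.
rewrite Dpoly_stat_sum.
pose psi f k i j : {poly int} :=
  if i == 0%N then 'X^(f + k) * ((1 + 'X) ^+ 2) ^+ (k + j) else 0.
transitivity (stat_sum n psi); last first.
  rewrite big_mkcond; apply: eq_bigr => s _; rewrite no_double_exc_count /psi.
  case: eqP => // dasc0.
  have := sum_count_types s; rewrite wex_count valleys_eq_peaks dasc0 !addn0.
  by move=> sum_n; congr (_ * _ ^+ _); lia.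
set phi := fun f k i j : nat => _.
have iter_phi m f k i j :
    iter m (@merge_op _) phi f k i j = phi f k i j * (1 + 'X) ^+ 2 ^+ m.
  elim: m f k i j => [|m IHm] f k i j; first by rewrite mulr1.
  by rewrite iterS /merge_op !IHm /phi !addnS !exprS; ring.
have iter_psi m f k i j :
    iter m (@merge_op _) psi f k i j = psi f k i j * (1 + 'X) ^+ 2 ^+ m.
  elim: m f k i j => [|m IHm] f k i j; first by rewrite mulr1.
  rewrite iterS /merge_op !IHm /psi /= !addnS !exprS.
  by case: eqP => _; ring.
apply: eq_stat_sum_merge => m f k; rewrite iter_phi iter_psi /phi /psi /=.
by rewrite !addn0 addnn -mul2n exprM.
Qed.

(** * Summing out the drop colorings *)

Lemma wex_le n (s : 'S_n) : (wex s <= n)%N.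
Proof. by rewrite -[leqRHS]card_ord max_card. Qed.

Lemma drop_coloring_count n (s : 'S_n) c : is_drop_coloring s c ->
  (wex s + cdrop c + \sum_i (is_drop s i && (c i == None)) = n)%N.
Proof.
move=> /forallP dc; rewrite -[RHS]card_ord /wex /cdrop -!sum1_card.
rewrite !(big_mkcond (fun i => i \in _)) -!big_split /=; apply: eq_bigr => i _.
by have := dc i; rewrite !inE /is_drop; case: leqP; case: (c i).
Qed.

Lemma sum_card_fiber (R : pzSemiRingType) (T : finType) (A : {set T})
    (h : T -> nat) (n : nat) (g : nat -> R) :
  (forall x, x \in A -> (h x <= n)%N) ->
  \sum_(k < n.+1) #|[set x in A | h x == k]|%:R * g k = \sum_(x in A) g (h x).
Proof.
move=> h_le; rewrite (partition_big (fun x => inord (h x) : 'I_n.+1) predT) //=.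
apply: eq_bigr => k _; rewrite mulr_natl -sumr_const; apply: eq_big => [x|x].
  rewrite inE; case Ax: (x \in A) => //=.
  by rewrite -val_eqE /= inordK // ltnS h_le.
by rewrite inE => /andP[_ /eqP->].
Qed.

Lemma sum_gammahat2 (R : pzSemiRingType) n (g : nat -> R) :
  \sum_(k < n.+1) (gammahat2 n k)%:R * g k
  = \sum_(x in Zset n) g (wex x.1 + cdrop x.2)%N.
Proof.
apply: sum_card_fiber => x; rewrite inE => /andP[/drop_coloring_count sum_n _].
by rewrite -[leqRHS]sum_n leq_addr.
Qed.

Lemma sum_gamma2 (R : pzSemiRingType) n (g : nat -> R) :
  \sum_(k < n.+1) (gamma2 n k)%:R * g k
  = \sum_(s : 'S_n | no_double_exc s) g (wex s).
Proof.
transitivity (\sum_(s in [set s : 'S_n | no_double_exc s]) g (wex s)); last first.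
  by apply: eq_bigl => s; rewrite inE.
rewrite -(@sum_card_fiber _ _ _ _ n) => [|s _]; last exact: wex_le.
apply: eq_bigr => k _; congr (#|pred_of_set _|%:R * _).
by apply/setP => s; rewrite !inE andbC.
Qed.

Lemma sum_drop_colorings (R : comNzRingType) n (s : 'S_n) (a b : R) :
  \sum_(c | is_drop_coloring s c) a ^+ cdrop c * b ^+ (n - (wex s + cdrop c))
  = (b + 2 * a) ^+ (n - wex s).
Proof.
(* The weight 0 of a colored non-drop removes the colorings that are not drop colorings; each drop
   contributes [b] uncolored and [a] for each of two colors. *)
pose W i (o : option bool) : R :=
  if is_drop s i then if o == None then b else a else (o == None)%:R.
transitivity (\prod_i \sum_o W i o); last first.
  rewrite (eq_bigr (fun i => (b + 2 * a) ^+ (is_drop s i))) => [|i _].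
    rewrite prodrXr; congr (_ ^+ _); apply/eqP; rewrite -(eqn_add2l (wex s)).
    rewrite subnKC ?wex_le // /wex -sum1_card big_mkcond -big_split /=.
    rewrite (eq_bigr (fun=> 1%N)) ?sum1_card ?card_ord // => i _.
    by rewrite inE /is_drop; case: leqP.
  rewrite (bigD1 None) //= (bigD1 (Some true)) //= (bigD1 (Some false)) //=.
  rewrite big1 => [|[[]|] //]; rewrite /W; case: is_drop => /=; ring.
rewrite bigA_distr_bigA big_mkcond; apply: eq_bigr => c _.
case: ifPn => [dc|]; last first.
  rewrite negb_forall => /existsP[i]; rewrite negb_imply => /andP[ci /negbTE di].
  by rewrite (bigD1 i) //= /W di (negbTE ci) mul0r.
have -> : (n - (wex s + cdrop c) = \sum_i (is_drop s i && (c i == None)))%N.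
  by rewrite -[X in (X - _)%N = _](drop_coloring_count dc) addKn.
rewrite /cdrop -sum1_card big_mkcond -!prodrXr -big_split /=.
apply: eq_bigr => i _; have /forallP/(_ i) := dc; rewrite inE /W.
by case: is_drop; case: (c i) => //= *; rewrite ?expr0 ?expr1 ?mulr1 ?mul1r.
Qed.

(** Used with [a = 'X] twice: [b = 1] gives the generating polynomial of [gammahat2 n], and
    [b = 1 + 'X^2] makes [b + 2 * a] the square [(1 + 'X) ^+ 2] of [Dpoly_no_double_exc]. *)
Lemma sum_Zset (R : comNzRingType) n (a b : R) :
  \sum_(x in Zset n)
     a ^+ (wex x.1 + cdrop x.2) * b ^+ (n - (wex x.1 + cdrop x.2))
  = \sum_(s : 'S_n | no_double_exc s) a ^+ wex s * (b + 2 * a) ^+ (n - wex s).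
Proof.
under [RHS]eq_bigr => s _ do rewrite -sum_drop_colorings mulr_sumr.
rewrite pair_big_dep; apply: eq_big => [x|x _] /=; first by rewrite inE andbC.
by rewrite exprD mulrA.
Qed.

(** * The binomial formula by comparing coefficients *)

Lemma coef_exp_1D2X m j :
  ((1 + 2 * 'X : {poly int}) ^+ m)`_j = (2 ^ j * 'C(m, j))%:R.
Proof.
rewrite exprDn coef_sum.
under eq_bigr => i _ do
  rewrite expr1n mul1r exprMn -natrX mulr_natl !coefMn coefXn -mulrnA.
have [le_jm|lt_mj] := leqP j m; last first.
  rewrite bin_small // muln0 big1 // => i _.
  by rewrite gtn_eqF ?mul0rn // (leq_ltn_trans _ lt_mj) // -ltnS.
rewrite (bigD1 (inord j)) //= inordK // eqxx big1 ?addr0 // => i neq_ij.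
by rewrite -[j](@inordK m) // val_eqE eq_sym (negbTE neq_ij) mul0rn.
Qed.

Lemma gammahat2_gamma2 n k : (k <= n)%N ->
  gammahat2 n k = (\sum_(i < k.+1) gamma2 n i * 2 ^ (k - i) * 'C(n - i, k - i))%N.
Proof.
move=> le_kn.
have /(congr1 (fun p : {poly int} => p`_k)) := sum_Zset n ('X : {poly int}) 1.
under eq_bigr => x _ do rewrite expr1n mulr1.
rewrite -(sum_gammahat2 n (fun m => 'X^m)).
rewrite -(sum_gamma2 n (fun m => 'X^m * (1 + 2 * 'X) ^+ (n - m))).
rewrite !coef_sum (bigD1 (inord k)) //= big1 ?addr0 => [|i neq_ik]; last first.
  rewrite mulr_natl coefMn coefXn -[k](@inordK n) // val_eqE eq_sym.
  by rewrite (negbTE neq_ik) mul0rn.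
rewrite inordK // mulr_natl coefMn coefXn eqxx => eq_k.
apply/eqP; rewrite -(Num.Theory.eqr_nat int) eq_k; apply/eqP.
rewrite (big_ord_widen n.+1 (fun i => gamma2 n i * 2 ^ (k - i) * 'C(n - i, k - i))%N) //.
rewrite [X in _ = X%:R]big_mkcond natr_sum; apply: eq_bigr => i _ /=.
rewrite mulr_natl coefMn coefXnM coef_exp_1D2X ltnS ltnNge.
by case: (i <= k)%N; rewrite /= ?mul0rn // -mulrnA mulnC mulnA.
Qed.

(** * A recurrence shared by both derangement polynomials *)

Definition der_rec (c : nat -> {poly int}) : Prop := forall n,
  c n.+1 = (1 + 2 * n%:R) * 'X^2 * c n + 'X * (1 - 'X^2) * (c n)^`()
           + 2 * 'X^2 * (n%:R * c n.-1).

(** One initial value suffices for this two-term recurrence, as [c n.-1] has factor 0 at [n = 0]. *)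
Lemma der_rec_uniq c c' : der_rec c -> der_rec c' -> c 0 = c' 0 -> c =1 c'.
Proof.
move=> rec_c rec_c' eq0 n.
suff [] : c n = c' n /\ c n.-1 = c' n.-1 by [].
by elim: n => [|n [IHn IHn1]] //; rewrite rec_c rec_c' IHn IHn1.
Qed.

Lemma der_recD c c' : der_rec c -> der_rec c' -> der_rec (fun n => c n + c' n).
Proof. by move=> rec_c rec_c' n; rewrite rec_c rec_c' derivD; ring. Qed.

Lemma der_rec_compN c : der_rec c -> der_rec (fun n => c n \Po (- 'X)).
Proof.
move=> rec_c n; rewrite rec_c deriv_comp derivN derivX.
rewrite !(comp_polyM, comp_polyB, comp_polyD, rmorphXn) /=.
rewrite !(rmorph_nat, rmorph1, comp_polyX) /=; ring.
Qed.

Lemma stat_sum_unfixE (R : comNzRingType) n (phi : nat -> nat -> nat -> nat -> R) :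
  n%:R * stat_sum n.-1 phi = stat_sum n (unfix_op phi).
Proof.
case: n => [|n]; last by rewrite stat_sum_unfix.
by rewrite stat_sum0 /unfix_op !mul0r.
Qed.

(** The logarithmic derivative is [a / 'X + b / (1 + 'X)], and the prefactor clears both
    denominators. *)
Lemma deriv_X_1DX a b :
  'X * (1 - 'X^2) * ('X^a * (1 + 'X) ^+ b)^`()
  = (a%:R * (1 - 'X^2) + b%:R * 'X * (1 - 'X)) * ('X^a * (1 + 'X) ^+ b)
  :> {poly int}.
Proof.
rewrite derivM derivXn deriv_exp derivD derivX derivC.
by case: a => [|a]; case: b => [|b] /=; rewrite ?exprS; ring.
Qed.

(** [insert_op] for index [n.+1] and [unfix_op] for index [n.-1] bring all terms to sums over the
    same ['S_n]; the identity then holds for each permutation separately. *)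
Lemma der_rec_Dpoly : der_rec (fun n => (1 + 'X) * Dpoly n).
Proof.
pose phi f k i j : {poly int} := 'X^(f + k + i) * (1 + 'X) ^+ (k + k + i + j).+1.
have DE n : (1 + 'X) * Dpoly n = stat_sum n phi.
  rewrite Dpoly_stat_sum mulr_sumr; apply: eq_bigr => s _.
  by rewrite /phi exprS; ring.
move=> n; rewrite !DE stat_sumS stat_sum_unfixE /stat_sum raddf_sum !mulr_sumr.
rewrite -!big_split; apply: eq_bigr => s _ /=.
have := sum_count_types s; rewrite valleys_eq_peaks.
move: (fixpts s) (peaks s) (dascs s) (ddescs s) => f k i j sum_n.
have {sum_n s} -> : n = (f + k + k + i + j)%N by lia.
rewrite deriv_X_1DX /insert_op /unfix_op /phi.
case: f => [|f]; case: i => [|i]; case: j => [|j];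
  rewrite /= !(addSn, addnS, addn0, add0n, exprS); ring.
Qed.

Lemma der_rec_dpoly : der_rec (fun n => dpoly n \Po 'X^2).
Proof.
pose phi f k i j : {poly int} := 'X^((f + k + i).*2) * 2 ^+ (k + k + i + j).
have dE n : dpoly n \Po 'X^2 = stat_sum n phi.
  rewrite dpoly_stat_sum raddf_sum; apply: eq_bigr => s _ /=.
  rewrite comp_polyM !rmorphXn /= comp_polyX rmorph_nat -exprM mul2n //.
have deriv_X2 a b : 'X * (1 - 'X^2) * ('X^(a.*2) * 2 ^+ b)^`()
    = 2 * a%:R * (1 - 'X^2) * ('X^(a.*2) * 2 ^+ b) :> {poly int}.
  rewrite derivM derivXn -natrX derivMn derivC.
  case: a => [|a]; rewrite ?doubleS /= ?exprS -?muln2; ring.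
move=> n; rewrite !dE stat_sumS stat_sum_unfixE /stat_sum raddf_sum !mulr_sumr.
rewrite -!big_split; apply: eq_bigr => s _ /=.
have := sum_count_types s; rewrite valleys_eq_peaks.
move: (fixpts s) (peaks s) (dascs s) (ddescs s) => f k i j sum_n.
have {sum_n s} -> : n = (f + k + k + i + j)%N by lia.
rewrite deriv_X2 /insert_op /unfix_op /phi.
case: f => [|f]; case: i => [|i]; case: j => [|j];
  rewrite /= !(addSn, addnS, addn0, add0n, doubleS, exprS); ring.
Qed.

Lemma dpoly_Dpoly n :
  2 * (dpoly n \Po 'X^2)
  = (1 + 'X) * Dpoly n + (1 - 'X) * (Dpoly n \Po (- 'X)).
Proof.
have D0 : Dpoly 0 = 1 by rewrite Dpoly_stat_sum stat_sum0 mulr1.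
have d0 : dpoly 0 = 1 by rewrite dpoly_stat_sum stat_sum0 mulr1.
have recD := der_recD der_rec_Dpoly (der_rec_compN der_rec_Dpoly).
have recd := der_recD der_rec_dpoly der_rec_dpoly.
have -> : 2 * (dpoly n \Po 'X^2) = (dpoly n \Po 'X^2) + (dpoly n \Po 'X^2).
  by ring.
rewrite (der_rec_uniq recd recD) ?D0 ?d0.
  by rewrite comp_polyM comp_polyD rmorph1 comp_polyX.
by rewrite !comp_polyM comp_polyD !rmorph1 comp_polyX; ring.
Qed.

(** The right side is twice the even part of [(1 + 'X) * 'X^k], that is, of ['X^k + 'X^k.+1], where
    exactly one exponent is even. *)
Lemma Xuphalf k :
  2 * ('X^(uphalf k) \Po 'X^2) = (1 + 'X) * 'X^k + (1 - 'X) * ('X^k \Po (- 'X))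
  :> {poly int}.
Proof.
rewrite !rmorphXn /= !comp_polyX -exprM mul2n exprNn.
have -> : 'X^k = 'X^(odd k + k./2.*2) :> {poly int} by rewrite odd_double_half.
rewrite -signr_odd uphalf_half doubleD.
by case: (odd k) => /=; rewrite ?add0n ?expr0 ?exprD ?expr1; ring.
Qed.

Lemma comp_poly_X2_inj : injective (fun p : {poly int} => p \Po 'X^2).
Proof.
move=> p q eq_pq; apply/polyP => i.
have /(congr1 (fun r : {poly int} => r`_(i * 2))) := eq_pq.
by rewrite !coef_comp_poly_Xn // !dvdn_mull // !mulnK.
Qed.

Theorem theorem8 (n : nat) :
  [/\ forall k : nat, (k <= n)%N ->
        gammahat2 n k
        = (\sum_(i < k.+1) gamma2 n i * 2 ^ (k - i) * 'C(n - i, k - i))%N,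
      Dpoly n
      = (\sum_(k < n.+1) (gammahat2 n k)%:R * 'X^k * (1 + 'X^2) ^+ (n - k))%R
    & dpoly n
      = (\sum_(k < n.+1)
           (gammahat2 n k)%:R * 'X^(uphalf k) * (1 + 'X) ^+ (n - k))%R].
Proof.
have DE : Dpoly n = \sum_(k < n.+1)
    (gammahat2 n k)%:R * 'X^k * (1 + 'X^2) ^+ (n - k).
  under eq_bigr => k _ do rewrite -mulrA.
  rewrite (sum_gammahat2 n (fun k => 'X^k * (1 + 'X^2) ^+ (n - k))) sum_Zset.
  rewrite Dpoly_no_double_exc; apply: eq_bigr => s _.
  by congr (_ * _ ^+ _); ring.
split=> //; first exact: gammahat2_gamma2.
(* After substituting ['X^2] and doubling, [dpoly_Dpoly] applies to the expansion of [Dpoly n] term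
   by term, since [1 + 'X^2] is even. *)
apply: comp_poly_X2_inj; apply: (@mulfI _ 2).
  by rewrite -polyC_natr polyC_eq0.
rewrite /= dpoly_Dpoly DE !raddf_sum !mulr_sumr -big_split; apply: eq_bigr => k _ /=.
rewrite !comp_polyM !rmorph_nat !(rmorphXn, rmorphD, rmorph1) /= !comp_polyX.
have := Xuphalf k.
rewrite !rmorphXn /= !comp_polyX sqrrN => Xk.
transitivity ((gammahat2 n k)%:R * (2 * 'X^2 ^+ uphalf k) * (1 + 'X^2) ^+ (n - k) : {poly int}).
  by rewrite Xk; ring.
by ring.
Qed.
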